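(* Let $n\ge 7$ and let $G$ be a connected graph of order $n$. If $\rho(G)\ge \rho(L_n)$, then $G$ contains a HIST unless $G\cong L_n$.
   Context: All graphs are finite, simple and undirected. The order of a graph is its number of vertices. $\rho(G)$ denotes the spectral radius of $G$, i.e. the largest eigenvalue of its adjacency matrix. A homeomorphically irreducible spanning tree (HIST) of a connected graph $G$ is a spanning tree $T$ of $G$ such that $T$ has no vertex of degree $2$ (degree taken in $T$). $K_m$ and $P_m$ denote the complete graph and the path on $m$ vertices. $L_n$ is the graph of order $n$ obtained from disjoint copies of $K_{n-2}$ and $P_2$ by adding an edge joining one end vertex of $P_2$ to one vertex of $K_{n-2}$. *)

(* Defs.v *)
From HB Require Import structures.
From mathcomp Require Import all_boot all_order all_algebra.
From mathcomp Require Import classical_sets reals.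

Set Implicit Arguments.
Unset Strict Implicit.
Unset Printing Implicit Defensive.

Import Order.TTheory GRing.Theory Num.Theory.

(* Graphs are given by their adjacency relation on a finite vertex type. *)
Definition simple_graph (V : finType) (e : rel V) : Prop :=
  symmetric e /\ irreflexive e.

(* The empty graph is not connected. *)
Definition connected_graph (V : finType) (e : rel V) : Prop :=
  0 < #|V| /\ forall x y : V, connect e x y.

(* On a simple graph, a duplicate-free closed walk [:: x; y] is just an edge
   traversed back and forth: genuine cycles have at least three vertices. *)
Definition acyclic_graph (V : finType) (e : rel V) : Prop :=
  forall c : seq V, ucycle e c -> size c <= 2.

Definition tree (V : finType) (e : rel V) : Prop :=
  [/\ simple_graph e, connected_graph e & acyclic_graph e].

Definition degree (V : finType) (e : rel V) (x : V) : nat :=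
  #|[set y | e x y]|.

Definition spanning_tree (V : finType) (e t : rel V) : Prop :=
  tree t /\ subrel t e.

Definition hist (V : finType) (e t : rel V) : Prop :=
  spanning_tree e t /\ forall x : V, degree t x <> 2.

Definition graph_iso (V W : finType) (e : rel V) (f : rel W) : Prop :=
  exists2 h : V -> W, bijective h & forall x y : V, f (h x) (h y) = e x y.

Definition complete_graph (m : nat) : rel 'I_m := fun i j => i != j.

Definition path_graph (m : nat) : rel 'I_m :=
  fun i j => (i.+1 == j :> nat) || (j.+1 == i :> nat).

(* Meaningful for n >= 3; the added edge joins the vertices numbered 0. *)
Definition L_graph (n : nat) : rel ('I_(n - 2) + 'I_2)%type :=
  fun x y =>
    match x, y with
    | inl i, inl j => complete_graph i j
    | inr i, inr j => path_graph i j
    | inl i, inr j | inr j, inl i => (i == 0 :> nat) && (j == 0 :> nat)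
    end.

Local Open Scope ring_scope.

Definition adjacency_matrix (R : realType) (V : finType) (e : rel V) :
    'M[R]_#|V| :=
  \matrix_(i, j) (e (enum_val i) (enum_val j))%:R.

(* The adjacency matrix of a nonempty simple graph is real symmetric, so it has
   a finite nonempty set of real eigenvalues and the supremum is a maximum. *)
Definition spectral_radius (R : realType) (V : finType) (e : rel V) : R :=
  sup [set a : R | eigenvalue (adjacency_matrix R e) a]%classic.

(* Main.v *)
(* Put n = k + 3. For a positive weight z with sum_(y ~ x) z y <= k z x at every
   vertex x, the spectral radius is at most k, while rho(L_n) > k. Weight 1 thus
   forces a vertex v of degree at least n - 2. If v is adjacent to all vertices,
   the star at v is a HIST. Otherwise v misses one vertex w; if some neighbour x
   of w has a further neighbour y, then hanging w and y from x and the other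
   vertices from v gives a HIST. If there is no such x, explicit weights show
   rho <= k when w has degree at least 2, or when w has degree 1 and an edge of
   the copy of K_(n-2) is missing; the only remaining graph is L_n. *)
Require Import Defs.
From HB Require Import structures.
From mathcomp Require Import all_boot all_order all_algebra.
From mathcomp Require Import classical_sets reals.
From mathcomp Require Import zify ring lra.

Set Implicit Arguments.
Unset Strict Implicit.
Unset Printing Implicit Defensive.

Import Order.TTheory GRing.Theory Num.Theory.

(** * Eigenvalues, weighted upper bounds, and the spectral radius of L_n *)

Section SpectralRadius.
Local Open Scope ring_scope.
Variables (R : realType) (V : finType) (e : rel V).

(** Frees later arguments from the enumeration of [V]. Since [eigenvalue] acts on row vectors, the
    sum is over [e y x]. *)
Lemma eigenvalue_adjacencyP (a : R) :
  reflect (exists2 u : V -> R, (forall x, \sum_(y | e y x) u y = a * u x)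
                             & exists x, u x != 0)
          (eigenvalue (adjacency_matrix R e) a).
Proof.
have mulE (u : V -> R) (x : V) :
    \sum_(j < #|V|) u (enum_val j) * (e (enum_val j) x)%:R = \sum_(y | e y x) u y.
  rewrite -(big_enum_val (fun y => u y * (e y x)%:R)) [RHS]big_mkcond /=.
  by apply: eq_bigr => y _; case: (e y x); rewrite ?mulr1 ?mulr0.
apply: (iffP eigenvalueP) => [[w wA w_neq0]|[u uA [x ux_neq0]]].
  exists (fun x => w 0 (enum_rank x)).
    move=> x; have /rowP/(_ (enum_rank x)) := wA; rewrite !mxE => <-.
    rewrite -mulE; apply: eq_bigr => j _.
    by rewrite mxE enum_valK enum_rankK.
  have /rV0Pn[j wj_neq0] := w_neq0.
  by exists (enum_val j); rewrite enum_valK.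
exists (\row_j u (enum_val j)).
  apply/rowP => j; rewrite !mxE -uA -mulE.
  by apply: eq_bigr => i _; rewrite !mxE.
by apply/rV0Pn; exists (enum_rank x); rewrite mxE enum_rankK.
Qed.

(* Pair the eigenvalue inequality a |u| <= A |u| with the weight vector z. *)
Lemma eigenvalue_le_weight (z : V -> nat) (k : nat) (a : R) :
    (forall x, (0 < z x)%N) ->
    (forall x, (\sum_(y | e x y) z y <= k * z x)%N) ->
  eigenvalue (adjacency_matrix R e) a -> a <= k%:R.
Proof.
move=> z_gt0 zA /eigenvalue_adjacencyP[u uA [x0 ux0]].
pose S := \sum_x (z x)%:R * `|u x|.
have S_gt0 : 0 < S.
  rewrite /S (bigD1 x0) //= ltr_wpDr ?sumr_ge0 // => [x _|].
    by rewrite mulr_ge0.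
  by rewrite mulr_gt0 ?normr_gt0 // ltr0n.
rewrite -(ler_pM2r S_gt0) (le_trans (ler_norm _)) // normrM (gtr0_norm S_gt0).
have -> : `|a| * S = \sum_x (z x)%:R * `|\sum_(y | e y x) u y|.
  by rewrite /S mulr_sumr; apply: eq_bigr => x _; rewrite uA normrM mulrCA.
apply: (@le_trans _ _ (\sum_x \sum_(y | e y x) (z x)%:R * `|u y|)).
  apply: ler_sum => x _; rewrite -mulr_sumr ler_wpM2l //.
  exact: ler_norm_sum.
(* After the exchange, [|u y|] is multiplied by the sum of [z] over the neighbours of [y], at most
   [k * z y]. *)
rewrite (exchange_big_dep predT) //= /S mulr_sumr; apply: ler_sum => y _.
by rewrite -mulr_suml mulrA ler_wpM2r // -natr_sum -natrM ler_nat.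
Qed.

Lemma spectral_radius_le_weight (z : V -> nat) (k : nat) :
    (forall x, (0 < z x)%N) ->
    (forall x, (\sum_(y | e x y) z y <= k * z x)%N) ->
  spectral_radius R e <= k%:R.
Proof.
move=> z_gt0 zA; rewrite /spectral_radius; set E := [set a | _]%classic.
(* The supremum of the empty set is 0 by convention. *)
have [->|E_neq0] := eqVneq E set0; first by rewrite sup0.
apply: ge_sup; first exact/set0P.
by move=> a; apply: eigenvalue_le_weight z_gt0 zA.
Qed.

Lemma eigenvalue_le_spectral_radius (a : R) :
  eigenvalue (adjacency_matrix R e) a -> a <= spectral_radius R e.
Proof.
(* The set must be bounded above for its supremum to bound it; weight 1 bounds every eigenvalue by
   the order. *)
apply: ub_le_sup; exists #|V|%:R => b /=.
apply: (eigenvalue_le_weight (z := fun=> 1)) => // x.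
by rewrite sum1_card muln1 max_card.
Qed.

End SpectralRadius.

(* An eigenvector with value 1 off the path and the attachment vertex must take
   the values a, b, c at the attachment vertex and along the path; the equation
   at the end vertex is q = 0, which has a root above k. *)
Lemma spectral_radius_L_graph_gt (R : realType) (k : nat) :
  (0 < k)%N -> (k%:R < spectral_radius R (@L_graph k.+3))%R.
Proof.
move=> k_gt0; pose K : R := k%:R%R.
have K_ge1 : (1 <= K)%R by rewrite ler1n.
pose a (l : R) := (l - K + 1)%R; pose b (l : R) := (l * a l - K)%R.
pose c (l : R) := (l * b l - a l)%R.
pose qa : {poly R} := ('X - K%:P + 1)%R.
pose qb : {poly R} := ('X * qa - K%:P)%R.
pose q : {poly R} := ('X * ('X * qb - qa) - qb)%R.
have qE (l : R) : (q.[l] = l * c l - b l)%R.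
  by rewrite /q /qb /qa !hornerE /c /b /a.
(* At [K] the values of [a], [b], [c] are 1, 0, -1, so q = -K < 0; at [K + 1], q = K^3 + 4K^2 + 2K -
   2 > 0. *)
have [] := @poly_ivt R q K (K + 1)%R.
- by rewrite lerDl.
- by rewrite !qE /c /b /a; apply/andP; split; nra.
move=> l /andP[K_le _] /rootP; rewrite qE => l_root.
have K_lt : (K < l)%R.
  rewrite lt_neqAle K_le andbT; apply/eqP => Kl; move: l_root.
  by rewrite -Kl /c /b /a; nra.
apply: (lt_le_trans K_lt); apply: eigenvalue_le_spectral_radius.
apply/eigenvalue_adjacencyP.
pose u (x : 'I_(k.+3 - 2) + 'I_2) : R := match x with
  | inl i => if i == 0 :> nat then a l else 1%R
  | inr j => if j == 0 :> nat then b l else c l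
  end.
exists u; last first.
  have k_lt : k < k.+3 - 2 by [].
  by exists (inl (Ordinal k_lt)); rewrite /u /= gtn_eqF ?oner_eq0.
move=> x; rewrite big_sumType /= [X in (_ + X)%R]big_mkcond.
rewrite [X in (X + _)%R]big_mkcond /=.
rewrite (big_ord_recl k) !(big_ord_recl _) big_ord0 /=.
case: x => [i|j] /=; last first.
  rewrite big1 // /path_graph.
  case: j => [[|[|//]] jP] /=; rewrite /bump /= ?addr0 ?add0r /c /b //.
    by ring.
  by move: l_root; rewrite /c /b; nra.
rewrite -big_mkcond /= sumr_const.
case: (unliftP ord0 i) => [i'|] -> /=; rewrite /complete_graph /=.
  rewrite (eq_card (B := predC1 i')) ?cardC1 ?card_ord; last first.
    by move=> x; rewrite !inE.
  rewrite /bump /= !addr0 /a mulr1.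
  have -> : K = (k.-1%:R + 1)%R by rewrite natr1 prednK.
  by ring.
rewrite (eq_card (B := 'I_k)) ?card_ord //= !addr0 add0r /b /K.
by ring.
Qed.

(** * Trees given by a parent function, and double stars *)

Section ParentRel.
Variables (V : finType) (r : V) (par : V -> V) (rk : V -> nat).

(** The root is its own parent; [a != b] removes that loop. *)
Definition parent_rel : rel V :=
  fun a b => (a != b) && ((par a == b) || (par b == a)).

Hypothesis par_root : par r = r.
Hypothesis rk_par : forall a, a != r -> rk (par a) < rk a.

Lemma parent_rel_sym : symmetric parent_rel.
Proof. by move=> a b; rewrite /parent_rel eq_sym orbC. Qed.

(** Were [a] the parent of [b] instead, the rank would strictly drop from [b] to [a]. *)
Lemma parent_rel_neq a b : parent_rel a b -> rk b <= rk a -> b = par a.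
Proof.
move=> /andP[ab /orP[/eqP//|/eqP parb]] rkba.
have b_neq : b != r by apply: contra ab => /eqP br; rewrite -parb br par_root.
by have := rk_par b_neq; rewrite parb ltnNge rkba.
Qed.

(* A vertex of maximal rank on a cycle has its parent as only neighbour. *)
Lemma parent_rel_acyclic : acyclic_graph parent_rel.
Proof.
move=> c0 c0_cycle; rewrite leqNgt; apply/negP => c0_size.
have [x0 x0c] : exists x0, x0 \in c0.
  by case: c0 c0_size {c0_cycle} => // x s _; exists x; rewrite mem_head.
have [a ac a_max] := arg_maxnP (P := [in c0]) rk x0c.
have [i s c0E] := rot_to ac.
have : ucycle parent_rel (a :: s) by rewrite -c0E rot_ucycle.
have : 2 < size (a :: s) by rewrite -c0E size_rot.
have {}a_max b : b \in a :: s -> rk b <= rk a.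
  by rewrite -c0E mem_rot; apply: a_max.
case: s {c0E} a_max => // b s a_max; case/lastP: s a_max => // s l a_max _.
case/andP; rewrite /= rcons_path last_rcons => /and3P[ab _ la] /and3P[_ bs _].
(* [b] and [l] are the two neighbours of [a] on the cycle; both are its parent, yet a cycle has no
   duplicates. *)
have bl : b = l.
  rewrite (parent_rel_neq ab) ?a_max ?inE ?eqxx ?orbT //.
  rewrite parent_rel_sym in la.
  by rewrite (parent_rel_neq la) ?a_max ?inE ?mem_rcons ?inE ?eqxx ?orbT.
by rewrite bl mem_rcons mem_head in bs.
Qed.

Lemma parent_rel_connected : connected_graph parent_rel.
Proof.
split; first by apply/card_gt0P; exists r.
have csym := sym_connect_sym parent_rel_sym.
suff root_conn a : connect parent_rel a r.
  by move=> a b; apply: (connect_trans (root_conn a)); rewrite csym.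
have [m] := ubnP (rk a); elim: m a => // m IHm a a_lt.
have [->//|a_neq] := eqVneq a r.
have rk_lt := rk_par a_neq.
apply: (@connect_trans _ _ (par a)); last by apply: IHm; lia.
apply: connect1; rewrite /parent_rel eqxx andbT.
by apply: contraTneq rk_lt => <-; rewrite ltnn.
Qed.

Lemma parent_rel_tree : tree parent_rel.
Proof.
split; [split|exact: parent_rel_connected|exact: parent_rel_acyclic].
  exact: parent_rel_sym.
by move=> a; rewrite /parent_rel eqxx.
Qed.

End ParentRel.

(* The tree has centres v and x, where C hangs from x and all other vertices
   hang from v; it is a star when C is empty. *)
Lemma hist_double_star (V : finType) (e : rel V) (v x : V) (C : {set V}) :
    symmetric e -> x != v -> v \notin C -> x \notin C ->
    (forall b, b \in C -> e x b) ->
    (forall b, b != v -> b \notin C -> e v b) ->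
    #|C| != 1 -> #|C| + 3 != #|V| ->
  exists t, hist e t.
Proof.
move=> e_sym x_neq vC xC e_x e_v C1 C3.
pose par z := if z \in C then x else v.
pose rk z := if z == v then 0 else if z \in C then 2 else 1.
have par_v : par v = v by rewrite /par (negPf vC).
have rk_par a : a != v -> rk (par a) < rk a.
  rewrite /rk /par => /negPf ->.
  by case: (a \in C); rewrite ?eqxx ?(negPf x_neq) ?(negPf xC).
exists (parent_rel par); split.
  split; first exact: parent_rel_tree par_v rk_par.
  have par_e a : a != par a -> e (par a) a.
    rewrite /par; case: ifPn => aC; first by move=> _; apply: e_x.
    by move=> av; apply: e_v.
  move=> a b /andP[ab /orP[] /eqP parE].
    by rewrite e_sym -parE par_e // parE.
  by rewrite -[in e a]parE par_e // parE eq_sym.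
move=> a; rewrite /degree.
(* The degrees are |V| - |C| - 1 at [v], |C| + 1 at [x] and 1 elsewhere; the two conditions on |C|
   keep them from being 2. *)
have [->|av] := eqVneq a v.
  rewrite (_ : [set _ | _] = ~: (v |: C)).
    have := cardsC (v |: C); rewrite cardsU1 vC => V_eq C_eq.
    by case/eqP: C3; rewrite -V_eq C_eq -addnA addnCA.
  apply/setP => b; rewrite !inE /parent_rel par_v negb_or.
  have [->|bv] := eqVneq v b; rewrite ?eqxx //= /par.
  by case: (b \in C); rewrite ?eqxx ?(negPf x_neq).
have [->|ax] := eqVneq a x.
  rewrite (_ : [set _ | _] = v |: C).
    by rewrite cardsU1 vC => -[]; apply/eqP.
  apply/setP => b; rewrite !inE /parent_rel /par (negPf xC).
  have [->|bv] := eqVneq b v; first by rewrite x_neq.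
  have [bC|bC] := boolP (b \in C); last by rewrite orFb [v == x]eq_sym (negPf x_neq) andbF.
  by rewrite eqxx andbT; apply: contra xC => /eqP ->.
rewrite (_ : [set _ | _] = [set par a]) ?cards1 //.
apply/setP => b; rewrite !inE /parent_rel.
have -> : (par b == a) = false.
  by rewrite /par; case: ifP => _; rewrite eq_sym ?(negPf ax) ?(negPf av).
rewrite orbF [b == _]eq_sym.
have [parE|] := eqVneq (par a) b; last by rewrite andbF.
rewrite andbT -parE; apply: contraTneq (rk_par a av) => <-.
by rewrite ltnn.
Qed.

(** * Weights that bound the spectral radius by [k] *)

Section WeightBounds.
Variables (R : realType) (V : finType) (e : rel V).

Lemma degreeE x : degree e x = \sum_(y | e x y) 1.
Proof. by rewrite /degree -sum1dep_card. Qed.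

(** Evaluates the corrections at single vertices in otherwise constant weights. *)
Lemma sum_adj_eq x v : \sum_(y | e x y) (y == v) = e x v.
Proof.
rewrite big_mkcond (bigD1 v) //= eqxx big1 ?addn0; first by case: (e x v).
by move=> y /negPf ->; case: (e x y).
Qed.

Lemma degree_add_nonadj_le x (s : seq V) :
  uniq s -> all (fun y => ~~ e x y) s -> degree e x + size s <= #|V|.
Proof.
move=> /card_uniqP <- /allP s_nonadj; rewrite -cardUI /= [X in _ + X]eq_card0.
  by rewrite addn0 max_card.
move=> y; rewrite !inE; apply/negP => /andP[exy ys].
by have := s_nonadj y ys; rewrite exy.
Qed.

Lemma degree_le_size x (s : seq V) :
  (forall y, e x y -> y \in s) -> degree e x <= size s.
Proof.
move=> e_s; apply: leq_trans (card_size s).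
by apply/subset_leq_card/fintype.subsetP => y; rewrite inE; apply: e_s.
Qed.

Lemma spectral_radius_le_degree (k : nat) :
  (forall x, degree e x <= k) -> (spectral_radius R e <= k%:R)%R.
Proof.
move=> deg_le; apply: (@spectral_radius_le_weight R V e (fun=> 1) k) => // x.
by rewrite -degreeE muln1.
Qed.

Hypotheses (e_sym : symmetric e) (e_irr : irreflexive e).
Variables (k : nat) (v w : V).
Hypotheses (V_card : #|V| = k.+3) (k_ge4 : 4 <= k).
Hypotheses (vw : v != w) (evw : ~~ e v w).
Hypothesis w_nbr : forall x y, e w x -> e x y -> (y == v) || (y == w).

Let ewv : e w v = false. Proof. by rewrite e_sym (negPf evw). Qed.

Lemma spectral_radius_le_degree_gt1 :
  1 < degree e w -> (spectral_radius R e <= k%:R)%R.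
Proof.
move=> w_deg; pose z y := 1 + (y == v) + (y == w).
apply: (@spectral_radius_le_weight R V e z k) => // u.
rewrite !big_split /= -degreeE !sum_adj_eq /z.
have [->|uv] := eqVneq u v.
  have := @degree_add_nonadj_le v [:: v; w].
  rewrite /= !inE vw e_irr evw V_card (negPf vw) => /(_ isT isT).
  move: k_ge4; lia.
have [->|uw] := eqVneq u w.
  have := @degree_add_nonadj_le w [:: v; w].
  rewrite /= !inE vw e_irr ewv V_card => /(_ isT isT).
  move: k_ge4; lia.
(* A neighbour of [w] sees at most [v] and [w], both of weight 2: the sum is at most 4, hence at
   most [k]. *)
have [ewu|ewu] := boolP (e w u).
  have : degree e u <= size [:: v; w].
    by apply: degree_le_size => y; rewrite !inE; apply: w_nbr.
  by move: k_ge4; rewrite /=; case: (e u v); case: (e u w); lia.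
have euw : e u w = false by rewrite e_sym (negPf ewu).
(* By [w_nbr], [u] misses itself, [w] and the at least two neighbours of [w]. Its degree is at most
   k - 1, leaving room for the extra 1 at [v]. *)
have := @degree_add_nonadj_le u [:: u, w & enum [set y | e w y]].
rewrite /= !inE !mem_enum !inE enum_uniq !e_irr (negPf uw) (negPf ewu) euw -cardE.
rewrite -/(degree e w) V_card => /(_ isT).
case: allP => [_ /(_ isT)|].
  by move: w_deg k_ge4; case: (e u v); lia.
case=> y; rewrite mem_enum inE e_sym => eyw; apply/negP => euy.
rewrite e_sym in eyw; rewrite e_sym in euy.
by have := w_nbr eyw euy; rewrite (negPf uv) (negPf uw).
Qed.

(* Weight k + 1 on p and q, weight k + 4 on v, weight k + 2 elsewhere. *)
Lemma spectral_radius_le_missing_edge (x p q : V) :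
    (forall y, e w y = (y == x)) ->
    p \notin [:: v; w; x] -> q \notin [:: v; w; x] -> p != q ->
    e v p -> e v q -> ~~ e p q ->
  (spectral_radius R e <= k%:R)%R.
Proof.
rewrite !inE !negb_or => ew /and3P[pv pw px] /and3P[qv qw qx] pq evp evq epq.
have ewx : e w x by rewrite ew.
have exw : e x w by rewrite e_sym.
have xw : x != w by apply: contraTneq ewx => ->; rewrite e_irr.
have xv : x != v by apply: contraTneq exw => ->.
have eyw y : y != x -> e y w = false by move=> yx; rewrite e_sym ew (negPf yx).
have eyx y : y != v -> y != w -> e y x = false.
  move=> yv yw; apply/negP; rewrite e_sym => /(w_nbr ewx).
  by rewrite (negPf yv) (negPf yw).
have eqp : e q p = false by rewrite e_sym (negPf epq).
pose z y := k + (y != p) + (y != q) + (y == v).*2.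
apply: (@spectral_radius_le_weight R V e z k) => [u|u].
  by rewrite /z -!addnA ltn_addr // (leq_trans _ k_ge4).
(* Relative to the constant weight k + 2, [p] and [q] fall short by 1 and [v] exceeds by 2. *)
have : \sum_(y | e u y) z y + (e u p + e u q) = k.+2 * degree e u + (e u v).*2.
  rewrite -!sum_adj_eq degreeE big_distrr -muln2 big_distrl -!big_split /=.
  apply: eq_bigr => y _; rewrite /z.
  by case: (y == p); case: (y == q); case: (y == v); rewrite /=; clear; lia.
move: (\sum_(y | _) _) => S; rewrite /z {z}.
have deg_le d D : d <= D -> k.+2 * d <= k.+2 * D by apply: leq_mul.
have [->|uv] := eqVneq u v.
  have := @degree_add_nonadj_le v [:: v; w].
  rewrite /= !inE vw e_irr evw V_card evp evq => /(_ isT isT).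
  rewrite addn2 !ltnS ![v == _]eq_sym pv qv => /deg_le.
  move: (degree e v) k_ge4; clear; lia.
have [->|uw] := eqVneq u w.
  have /deg_le : degree e w <= size [:: x].
    by apply: degree_le_size => y; rewrite ew inE.
  rewrite /= ewv ![w == _]eq_sym pw qw; move: (degree e w) k_ge4; clear; nia.
have [->|ux] := eqVneq u x.
  have /deg_le : degree e x <= size [:: v; w].
    by apply: degree_le_size => y; rewrite !inE; apply: w_nbr.
  rewrite /= ![x == _]eq_sym px qx.
  move: (degree e x) k_ge4; case: (e x v); clear; nia.
(* The tight case: [p] misses [p], [q], [w], [x], and (k + 2)(k - 1) + 2 = k(k + 1). *)
have [->|up] := eqVneq u p.
  have := @degree_add_nonadj_le p [:: p; q; w; x].
  rewrite /= !inE !negb_or pq pw px qw qx [w == x]eq_sym xw e_irr epq eyw // eyx //.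
  rewrite V_card => /(_ isT isT) /deg_le.
  move: (degree e p) k_ge4; case: (e p v); clear; lia.
have [->|uq] := eqVneq u q.
  have := @degree_add_nonadj_le q [:: p; q; w; x].
  rewrite /= !inE !negb_or pq pw px qw qx [w == x]eq_sym xw e_irr eqp eyw // eyx //.
  rewrite V_card => /(_ isT isT) /deg_le.
  move: (degree e q) k_ge4; case: (e q v); clear; lia.
have := @degree_add_nonadj_le u [:: u; w; x].
have := @degree_add_nonadj_le u [:: u; w; x; p].
have := @degree_add_nonadj_le u [:: u; w; x; q].
rewrite /= !inE !negb_or uw ux up uq e_irr eyw // eyx // ![x == _]eq_sym ![w == _]eq_sym.
rewrite pw px qw qx xw V_card.
move=> deg_q deg_p /(_ isT isT); rewrite addn3 !ltnS => deg_u.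
(* If [u] sees both [p] and [q], their deficits cancel the excess at [v]; otherwise [u] has a
   further non-neighbour, which saves a whole k + 2. *)
have /deg_le : degree e u + (~~ e u p || ~~ e u q) <= k.
  move: (degree e u) deg_u deg_p deg_q.
  by case: (e u p); case: (e u q); rewrite /=; clear; lia.
move: (degree e u) k_ge4.
by case: (e u p); case: (e u q); case: (e u v); rewrite /=; clear; lia.
Qed.

End WeightBounds.

(** * Recognition of L_n and the final case analysis *)

Lemma graph_iso_L_graph (V : finType) (e : rel V) (k : nat) (v w x : V) :
    symmetric e -> irreflexive e -> #|V| = k.+3 -> v != w -> v != x -> x != w ->
    e v x ->
    (forall y, e w y = (y == x)) ->
    (forall y, e x y -> (y == v) || (y == w)) ->
    (forall p q, p \notin [:: w; x] -> q \notin [:: w; x] -> p != q -> e p q) ->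
  graph_iso e (@L_graph k.+3).
Proof.
move=> e_sym e_irr V_card vw vx xw evx ew ex ecomplete.
(* [s] lists the clique, headed by [v] because the attachment vertex is numbered 0; [x] and [w] form
   the path. *)
pose s := v :: enum (~: [set v; w; x]).
have s_uniq : uniq s by rewrite /= mem_enum !inE eqxx enum_uniq.
have s_size : size s = k.+3 - 2.
  have := cardsC [set v; w; x]; rewrite -finset.setUA cardsU1 cards2 !inE negb_or.
  rewrite vw vx eq_sym xw V_card /= => -[<-].
  by rewrite -cardE -finset.setUA.
have s_mem i : i < k.+3 - 2 -> nth v s i \notin [:: w; x].
  rewrite -s_size => /(mem_nth v); rewrite inE mem_enum !inE.
  case/predU1P => [->|]; first by rewrite negb_or vw vx.
  by rewrite -orbA => /norP[].
pose g (a : 'I_(k.+3 - 2) + 'I_2) :=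
  match a with inl i => nth v s i | inr j => if j == 0 :> nat then x else w end.
have g_inj : injective g.
  move=> [i|[[|[|//]] jP]] [i'|[[|[|//]] jP']] /= gE.
  - by apply/congr1/val_inj/eqP; rewrite /= -(nth_uniq v _ _ s_uniq) ?s_size ?gE.
  - by have := s_mem i (ltn_ord i); rewrite gE !inE eqxx orbT.
  - by have := s_mem i (ltn_ord i); rewrite gE !inE eqxx.
  - by have := s_mem i' (ltn_ord i'); rewrite -gE !inE eqxx orbT.
  - by apply/congr1/val_inj.
  - by rewrite gE eqxx in xw.
  - by have := s_mem i' (ltn_ord i'); rewrite -gE !inE eqxx.
  - by rewrite gE eqxx in xw.
  - by apply/congr1/val_inj.
have [h gK hK] : bijective g.
  by apply: inj_card_bij => //; rewrite card_sum !card_ord V_card addn2.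
exists h; first by exists g.
have ewx : e w x by rewrite ew.
have ex_nth (i : 'I_(k.+3 - 2)) : e x (nth v s i) = (i == 0 :> nat).
  have [i0|i_neq0] := eqVneq (val i) 0; first by rewrite i0 /= e_sym.
  apply/negP => /ex /orP[]; apply/negP.
    by rewrite (nth_uniq v (j := 0) _ _ s_uniq) ?s_size.
  by have := s_mem i (ltn_ord i); rewrite !inE => /norP[].
have ew_nth (i : 'I_(k.+3 - 2)) : e w (nth v s i) = false.
  by rewrite ew; have := s_mem i (ltn_ord i); rewrite !inE => /norP[_ /negPf].
suff eg a b : L_graph a b = e (g a) (g b) by move=> y z; rewrite eg !hK.
case: a b => [i|[[|[|//]] jP]] [i'|[[|[|//]] jP']] //=.
- rewrite /complete_graph; have [->|ii'] := eqVneq i i'; first by rewrite e_irr.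
  by rewrite ecomplete ?s_mem ?ltn_ord ?nth_uniq ?s_size.
- by rewrite e_sym ex_nth andbT.
- by rewrite e_sym ew_nth andbF.
- by rewrite ex_nth andbT.
- by rewrite e_sym ewx.
- by rewrite ew_nth andbF.
Qed.

Theorem theorem1p1 (R : realType) (n : nat) (V : finType) (e : rel V)
    (n_ge7 : (7 <= n)%N) (e_simple : simple_graph e)
    (e_order : #|V| = n) (e_connected : connected_graph e)
    (e_rho : (spectral_radius R (@L_graph n) <= spectral_radius R e)%R) :
  ~ graph_iso e (@L_graph n) -> exists t : rel V, hist e t.
Proof.
case: n n_ge7 e_order e_rho => [|[|[|k]]] // k_ge4 V_card e_rho niso.
rewrite !ltnS in k_ge4.
have [e_sym e_irr] := e_simple; have [_ e_conn] := e_connected.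
have rho_gt : (k%:R < spectral_radius R e)%R.
  by apply: lt_le_trans e_rho; apply: spectral_radius_L_graph_gt; lia.
have rho_le_false : ~ (spectral_radius R e <= k%:R)%R.
  by rewrite leNgt rho_gt.
have [v v_deg] : exists v, k < degree e v.
  apply/existsP; apply: contra_notT rho_le_false => /existsPn deg_le.
  by apply: spectral_radius_le_degree => x; rewrite leqNgt.
(* One of these non-neighbours is [v] itself, so [v] misses at most one other vertex. *)
have nonadj_le s : uniq s -> all (fun y => ~~ e v y) s -> size s <= 2.
  move=> s_uniq s_nonadj; have := degree_add_nonadj_le s_uniq s_nonadj.
  by rewrite V_card; move: (degree e v) (size s) v_deg; clear; lia.
have [w /andP[wv evw]|v_dom] := pickP (fun w => (w != v) && ~~ e v w); last first.
  have v_adj y : y != v -> e v y.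
    by move=> yv; have := v_dom y; rewrite /= yv => /negbFE.
  have [x] : exists x, x \in [set y | e v y].
    by apply/card_gt0P; apply: leq_ltn_trans v_deg.
  rewrite inE => evx.
  (* With [C] empty this is the star at [v], and [x] is just one of its leaves. *)
  apply: (@hist_double_star V e v x finset.set0); rewrite ?inE ?cards0 ?V_card //.
  - by apply: contraTneq evx => ->; rewrite e_irr.
  - by move=> b; rewrite inE.
  - by move=> b bv _; apply: v_adj.
  - by move: k_ge4; clear; lia.
have v_adj y : y != v -> y != w -> e v y.
  move=> yv yw; apply: contraT => evy.
  have := nonadj_le [:: v; w; y]; rewrite /= !inE e_irr evw evy.
  rewrite eq_sym (negPf wv) [v == y]eq_sym (negPf yv) [w == y]eq_sym yw.
  by move=> /(_ isT isT).
have vw : v != w by rewrite eq_sym.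
have ewv : e w v = false by rewrite e_sym (negPf evw).
have [/existsP[x /existsP[y /and4P[ewx exy yv yw]]]|w_far] :=
    boolP [exists x, exists y, [&& e w x, e x y, y != v & y != w]].
  have xw : x != w by apply: contraTneq ewx => ->; rewrite e_irr.
  have xv : x != v by apply: contraTneq ewx => ->; rewrite ewv.
  have yx : y != x by apply: contraTneq exy => ->; rewrite e_irr.
  (* Here [x] gets degree 3 and [v] degree n - 3, at least 4. *)
  apply: (@hist_double_star V e v x [set w; y]) => //.
  - by rewrite !inE negb_or vw eq_sym.
  - by rewrite !inE negb_or xw eq_sym.
  - by move=> b; rewrite !inE => /orP[] /eqP -> //; rewrite e_sym.
  - by move=> b bv; rewrite !inE negb_or => /andP[bw _]; apply: v_adj.
  - by rewrite cards2 [w == y]eq_sym yw.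
  - by rewrite cards2 [w == y]eq_sym yw V_card; move: k_ge4; clear; lia.
have w_nbr x y : e w x -> e x y -> (y == v) || (y == w).
  move=> ewx exy; apply: contraNT w_far; rewrite negb_or => /andP[yv yw].
  by apply/existsP; exists x; apply/existsP; exists y; rewrite ewx exy yv.
have w_deg : degree e w <= 1.
  rewrite leqNgt; apply/negP => w_deg; apply: rho_le_false.
  exact: (spectral_radius_le_degree_gt1 _ e_sym e_irr V_card k_ge4 vw evw w_nbr).
have [x ewx] : exists x, e w x.
  (* [x] is the first step of a path from [w] to [v]. *)
  have /connectP[[|x p] /= wp vE] := e_conn w v; last by exists x; case/andP: wp.
  by rewrite vE eqxx in vw.
have ew y : e w y = (y == x).
  apply/idP/eqP => [ewy|->//].
  by apply: (card_le1_eqP w_deg); rewrite inE.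
have xw : x != w by apply: contraTneq ewx => ->; rewrite e_irr.
have xv : x != v by apply: contraTneq ewx => ->; rewrite ewv.
have [/existsP[p /existsP[q /and4P[pP qP pq epq]]]|complete] := boolP
    [exists p, exists q,
       [&& p \notin [:: w; x], q \notin [:: w; x], p != q & ~~ e p q]].
  case: rho_le_false.
  (* [v] is adjacent to every other vertex except [w], so it is not an end of the missing edge. *)
  have v_neq a b : b \notin [:: w; x] -> a != b -> ~~ e a b -> a != v.
    rewrite !inE negb_or => /andP[bw _] ab; apply: contraNneq => av.
    by rewrite av v_adj // -av eq_sym.
  have pv := v_neq p q qP pq epq.
  have qv : q != v by apply: (v_neq q p); rewrite // 1?eq_sym // e_sym.
  have adj_v a : a != v -> a \notin [:: w; x] -> e v a.
    by rewrite !inE negb_or => av /andP[aw _]; apply: v_adj.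
  apply: (spectral_radius_le_missing_edge _ e_sym e_irr V_card k_ge4 vw evw w_nbr ew)
    pq _ _ epq; rewrite ?adj_v // inE negb_or; exact/andP.
case: niso; apply: (graph_iso_L_graph e_sym e_irr V_card vw _ xw _ ew).
- by rewrite eq_sym.
- exact: v_adj.
- by move=> y; apply: w_nbr.
move=> p q pP qP pq; apply: contraNT complete => epq.
by apply/existsP; exists p; apply/existsP; exists q; rewrite pP qP pq.
Qed.
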